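(* Let $0\le\gamma<\sqrt n$ and $\zeta\ge0$ be such that $$\frac{\gamma^2(n-1)}{(n-\gamma)^2}+\frac{\zeta\gamma^2}{n}\le\zeta ,$$ and let $0<\delta<\min\left\{2,\frac{2n(n-\gamma)}{n^2+\zeta(n-\gamma)^2}\right\}$. Let $\{x_k\}$ be the random sequence generated by the SSKM algorithm (defined in the context) with parameters $\delta,\gamma$ from a starting point $x_0\in\mathbb{R}^n$, and define $\bar{x}_k=\frac1k\sum_{l=1}^{k}x_l$. Then for all $k\ge1$ $$\mathbb{E}[f(\bar{x}_k)]\le\frac{n(n-\gamma)^2\,d(x_0,P)^2+2\gamma\delta\,[n^2+\zeta(n-\gamma)^2]\,f(x_0)}{2\delta kn\left[2n(n-\gamma)-\zeta\delta(n-\gamma)^2-\delta n^2\right]} .$$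
   Context: Setting: $A\in\mathbb{R}^{m\times n}$ has rows $a_1^T,\dots,a_m^T$ with $\|a_i\|=1$ for all $i$, $b\in\mathbb{R}^m$, and $P=\{x\in\mathbb{R}^n: Ax\le b\}$ is nonempty. $\|\cdot\|$ is the Euclidean norm, $d(x,P)=\inf_{z\in P}\|x-z\|$, $u^+=\max\{u,0\}$. Fix a sample size $\beta\in\{1,\dots,m\}$. SSKM algorithm (Stochastic-Momentum Sampling Kaczmarz Motzkin): given $x_0\in\mathbb{R}^n$ (deterministic), set $x_1=x_0$; for $k\ge1$, choose a subset $\tau_k\subseteq\{1,\dots,m\}$ of size $\beta$ uniformly at random, let $i^*\in\arg\max_{i\in\tau_k}(a_i^Tx_k-b_i)^+$ (ties broken by any rule), pick $j_k\in\{1,\dots,n\}$ uniformly at random ($\tau_k$, $j_k$ independent of each other and of the past), and set $$x_{k+1}=x_k-\delta\,(a_{i^*}^Tx_k-b_{i^*})^+a_{i^*}+\gamma\,(x_k-x_{k-1})_{j_k}e_{j_k},$$ where $(v)_j$ is the $j$th coordinate of $v$ and $e_j$ the $j$th standard unit vector of $\mathbb{R}^n$. The function $f:\mathbb{R}^n\to\mathbb{R}$ is $f(x)=\frac12\,\mathbb{E}_\tau\big[\big(\max_{i\in\tau}(a_i^Tx-b_i)^+\big)^2\big]$, where $\tau$ is a uniformly random $\beta$-element subset of $\{1,\dots,m\}$. *)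

(* Defs.v *)
From HB Require Import structures.
From mathcomp Require Import all_boot all_order all_algebra.
From mathcomp Require Import all_classical all_reals all_analysis.
Set Implicit Arguments.
Unset Strict Implicit.
Unset Printing Implicit Defensive.
Import Order.TTheory GRing.Theory Num.Theory.
Local Open Scope classical_set_scope.
Local Open Scope ring_scope.

(* Euclidean norm; the norm `|x| that the library puts on matrices is the
   sup norm. *)
Definition enorm (R : realType) (n : nat) (x : 'cV[R]_n) : R :=
  Num.sqrt (\sum_(i < n) x i 0 ^+ 2).

Definition dist_to (R : realType) (n : nat) (x : 'cV[R]_n)
    (S : set 'cV[R]_n) : R :=
  inf [set enorm (x - z) | z in S].

Definition polyhedron (R : realType) (m n : nat) (A : 'M[R]_(m, n))
    (b : 'cV[R]_m) : set 'cV[R]_n :=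
  [set x | forall i : 'I_m, (A *m x) i 0 <= b i 0].

Definition row_vec (R : realType) (m n : nat) (A : 'M[R]_(m, n)) (i : 'I_m)
  : 'cV[R]_n := (row i A)^T.

Definition pos_residual (R : realType) (m n : nat) (A : 'M[R]_(m, n))
    (b : 'cV[R]_m) (x : 'cV[R]_n) (i : 'I_m) : R :=
  Num.max ((A *m x) i 0 - b i 0) 0.

(* The positive residuals are nonnegative, so the default value 0 of the
   iterated maximum is harmless when S is nonempty. *)
Definition max_residual (R : realType) (m n : nat) (A : 'M[R]_(m, n))
    (b : 'cV[R]_m) (x : 'cV[R]_n) (S : {set 'I_m}) : R :=
  \big[Num.max/0]_(i in S) pos_residual A b x i.

Definition sample_mean (R : realType) (m beta : nat) (g : {set 'I_m} -> R)
  : R :=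
  (\sum_(S : {set 'I_m} | #|S| == beta) g S) / ('C(m, beta))%:R.

Definition objective (R : realType) (m n beta : nat) (A : 'M[R]_(m, n))
    (b : 'cV[R]_m) (x : 'cV[R]_n) : R :=
  2^-1 * sample_mean beta (fun S => max_residual A b x S ^+ 2).

Definition average_iterate (R : realType) (n : nat) (x : nat -> 'cV[R]_n) (k : nat)
  : 'cV[R]_n :=
  k%:R^-1 *: \sum_(1 <= l < k.+1) x l.

(* The atoms of the sigma-algebra generated by the random choices made in the
   iterations 1, ..., k - 1; an atom is described by a history h, of which only
   the values at 1, ..., k - 1 matter. *)
Definition past (Omega : Type) (m n : nat) (tau : nat -> Omega -> {set 'I_m})
    (istar : nat -> Omega -> 'I_m) (j : nat -> Omega -> 'I_n)
    (h : nat -> {set 'I_m} * 'I_m * 'I_n) (k : nat) : set Omega :=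
  [set w | forall l, (0 < l < k)%N -> (tau l w, istar l w, j l w) = h l].

(* X is a run of SSKM on (Omega, P).  The tie-breaking rule for istar may
   depend on the past and on tau k, and may be randomized, but must not
   anticipate j k or later draws: this is why istar is part of the past, and
   why j k is independent of the past, tau k and istar k jointly.  As all
   draws take finitely many values, independence is stated on atoms. *)
Record is_SSKM (R : realType) (d : measure_display) (Omega : measurableType d)
    (P : probability Omega R) (m n beta : nat) (A : 'M[R]_(m, n))
    (b : 'cV[R]_m) (delta gamma : R) (x0 : 'cV[R]_n)
    (tau : nat -> Omega -> {set 'I_m}) (istar : nat -> Omega -> 'I_m)
    (j : nat -> Omega -> 'I_n) (X : nat -> Omega -> 'cV[R]_n) : Prop := {
  sskm_tau_measurable : forall k (S : {set 'I_m}), (0 < k)%N ->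
    measurable [set w | tau k w = S];
  sskm_istar_measurable : forall k (i : 'I_m), (0 < k)%N ->
    measurable [set w | istar k w = i];
  sskm_j_measurable : forall k (c : 'I_n), (0 < k)%N ->
    measurable [set w | j k w = c];
  sskm_tau_card : forall k w, (0 < k)%N -> #|tau k w| = beta;
  sskm_tau_uniform : forall k h (S : {set 'I_m}), (0 < k)%N -> #|S| = beta ->
    P (past tau istar j h k `&` [set w | tau k w = S]) =
    (P (past tau istar j h k) * (('C(m, beta))%:R^-1)%:E)%E;
  sskm_j_uniform : forall k h (S : {set 'I_m}) (i : 'I_m) (c : 'I_n),
    (0 < k)%N ->
    P (past tau istar j h k `&` [set w | tau k w = S]
         `&` [set w | istar k w = i] `&` [set w | j k w = c]) =
    (P (past tau istar j h k `&` [set w | tau k w = S]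
          `&` [set w | istar k w = i]) * (n%:R^-1)%:E)%E;
  sskm_istar_mem : forall k w, (0 < k)%N -> istar k w \in tau k w;
  sskm_istar_max : forall k w (i : 'I_m), (0 < k)%N -> i \in tau k w ->
    pos_residual A b (X k w) i <= pos_residual A b (X k w) (istar k w);
  sskm_init0 : forall w, X 0%N w = x0;
  sskm_init1 : forall w, X 1%N w = x0;
  sskm_step : forall k w, (0 < k)%N ->
    X k.+1 w = X k w
      - (delta * pos_residual A b (X k w) (istar k w))
          *: row_vec A (istar k w)
      + (gamma * (X k w - X k.-1 w) (j k w) 0) *: delta_mx (j k w) 0 }.

(* Main.v *)
(* Put th = gamma / (n - gamma), C = (1 + th)^2 + zeta, and fix z in P.  Since
   x_{k+1} + th (x_{k+1} - x_k) = x_k + (1 + th) (x_{k+1} - x_k), averaging over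
   the coordinate j_k gives heavy ball with momentum gamma / n plus a variance
   term, and the condition on zeta is exactly what makes
     L_k = |x_k + th (x_k - x_{k-1}) - z|^2 + zeta |x_k - x_{k-1}|^2
   absorb that variance.  With g the sampled residual times its row, the terms
   <g, x_k - z> and <g, x_k - x_{k-1}> are bounded below by 2 f(x_k) and, by the
   subgradient inequality, by f(x_k) - f(x_{k-1}), both in conditional mean.
   Hence, for r = 4 delta (1 + th) - 2 C delta^2 > 0,
     L_k + 2 delta (gamma / n) C f(x_{k-1}) + r sum_{1 <= l < k} f(x_l)
   is a supermartingale; compare its final and initial values, apply Jensen to
   the convex f, and minimize over z. *)
Require Import Defs.
From HB Require Import structures.
From mathcomp Require Import all_boot all_order all_algebra.
From mathcomp Require Import all_classical all_reals all_analysis.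
From mathcomp Require Import measurable_realfun.
From mathcomp Require Import ring lra.
Import Order.TTheory GRing.Theory Num.Theory.
Local Open Scope classical_set_scope.
Local Open Scope ring_scope.

Set Implicit Arguments.
Unset Strict Implicit.

(** * The Euclidean inner product on column vectors *)

Definition dotp (R : realType) (n : nat) (x y : 'cV[R]_n) : R :=
  \sum_(i < n) x i 0 * y i 0.

Lemma dotpC (R : realType) (n : nat) (x y : 'cV[R]_n) : dotp x y = dotp y x.
Proof. by apply: eq_bigr => i _; rewrite mulrC. Qed.

Lemma dotpDl (R : realType) (n : nat) (x y z : 'cV[R]_n) :
  dotp (x + y) z = dotp x z + dotp y z.
Proof. by rewrite -big_split; apply: eq_bigr => i _; rewrite mxE mulrDl. Qed.

Lemma dotpDr (R : realType) (n : nat) (x y z : 'cV[R]_n) :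
  dotp z (x + y) = dotp z x + dotp z y.
Proof. by rewrite dotpC dotpDl !(dotpC z). Qed.

Lemma dotpZl (R : realType) (n : nat) (a : R) (x y : 'cV[R]_n) :
  dotp (a *: x) y = a * dotp x y.
Proof. by rewrite mulr_sumr; apply: eq_bigr => i _; rewrite mxE mulrA. Qed.

Lemma dotpZr (R : realType) (n : nat) (a : R) (x y : 'cV[R]_n) :
  dotp x (a *: y) = a * dotp x y.
Proof. by rewrite dotpC dotpZl dotpC. Qed.

Lemma dotpNl (R : realType) (n : nat) (x y : 'cV[R]_n) :
  dotp (- x) y = - dotp x y.
Proof. by rewrite -scaleN1r dotpZl mulN1r. Qed.

Lemma dotpNr (R : realType) (n : nat) (x y : 'cV[R]_n) :
  dotp x (- y) = - dotp x y.
Proof. by rewrite dotpC dotpNl dotpC. Qed.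

Lemma dotp_sumr (R : realType) (n : nat) (I : Type) (s : seq I)
    (P : pred I) (F : I -> 'cV[R]_n) (x : 'cV[R]_n) :
  dotp x (\sum_(i <- s | P i) F i) = \sum_(i <- s | P i) dotp x (F i).
Proof.
apply: (big_morph (dotp x)) => [y z|]; first exact: dotpDr.
by rewrite -(scale0r x) dotpZr mul0r.
Qed.

Lemma dotp_delta (R : realType) (n : nat) (x : 'cV[R]_n) (c : 'I_n) :
  dotp x (delta_mx c 0) = x c 0.
Proof.
rewrite /dotp (bigD1 c)//= big1 => [|i /negbTE ic];
  by rewrite mxE eqxx ?ic ?eqxx ?mulr0// ?addr0 ?mulr1.
Qed.

Lemma enorm_sqr (R : realType) (n : nat) (x : 'cV[R]_n) :
  enorm x ^+ 2 = dotp x x.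
Proof.
rewrite /enorm sqr_sqrtr; last by apply: sumr_ge0 => i _; exact: sqr_ge0.
by apply: eq_bigr => i _; rewrite expr2.
Qed.

Lemma dotp_ge0 (R : realType) (n : nat) (x : 'cV[R]_n) : 0 <= dotp x x.
Proof. by rewrite -enorm_sqr sqr_ge0. Qed.

Lemma dotp_row_vec (R : realType) (m n : nat) (A : 'M[R]_(m, n)) (i : 'I_m)
    (x : 'cV[R]_n) : dotp (row_vec A i) x = (A *m x) i 0.
Proof. by rewrite mxE; apply: eq_bigr => l _; rewrite !mxE. Qed.

(** * Residuals over a fixed sample *)

Lemma pos_residual_ge0 (R : realType) (m n : nat) (A : 'M[R]_(m, n))
    (b : 'cV[R]_m) (x : 'cV[R]_n) (i : 'I_m) : 0 <= pos_residual A b x i.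
Proof. by rewrite le_max lexx orbT. Qed.

Lemma le_max_residual (R : realType) (m n : nat) (A : 'M[R]_(m, n))
    (b : 'cV[R]_m) (x : 'cV[R]_n) (S : {set 'I_m}) (i : 'I_m) :
  i \in S -> pos_residual A b x i <= max_residual A b x S.
Proof. by move=> iS; apply: le_bigmax_cond. Qed.

Lemma max_residual_eq (R : realType) (m n : nat) (A : 'M[R]_(m, n))
    (b : 'cV[R]_m) (x : 'cV[R]_n) (S : {set 'I_m}) (i : 'I_m) :
  i \in S ->
  (forall l, l \in S -> pos_residual A b x l <= pos_residual A b x i) ->
  max_residual A b x S = pos_residual A b x i.
Proof.
move=> iS hmax; apply/le_anti; rewrite le_max_residual// andbT.
by apply: bigmax_le => //; exact: pos_residual_ge0.
Qed.

Lemma max_residual_attained (R : realType) (m n : nat) (A : 'M[R]_(m, n))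
    (b : 'cV[R]_m) (x : 'cV[R]_n) (S : {set 'I_m}) :
  (0 < #|S|)%N ->
  exists2 i, i \in S & max_residual A b x S = pos_residual A b x i.
Proof.
move=> /card_gt0P[i0 i0S].
have [i iS hmax] := arg_maxP (P := mem S) (pos_residual A b x) i0S.
by exists i => //; apply: max_residual_eq.
Qed.

(** At [y] the maximum is at least the residual of row [i], so the claim reduces to the tangent
    inequality for u -> (u^+)^2, whose derivative is 2 u^+. *)
Lemma max_residual_subgradient (R : realType) (m n : nat) (A : 'M[R]_(m, n))
    (b : 'cV[R]_m) (x y : 'cV[R]_n) (S : {set 'I_m}) (i : 'I_m) :
  i \in S -> max_residual A b x S = pos_residual A b x i ->
  max_residual A b x S ^+ 2
    + 2 * pos_residual A b x i * dotp (row_vec A i) (y - x)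
  <= max_residual A b y S ^+ 2.
Proof.
move=> iS ->.
apply: (@le_trans _ _ (pos_residual A b y i ^+ 2)); last first.
  by rewrite lerXn2r ?nnegrE ?pos_residual_ge0 ?le_max_residual//;
    apply: le_trans (le_max_residual A b y iS); exact: pos_residual_ge0.
rewrite dotpDr dotpNr !dotp_row_vec /pos_residual.
set u := (A *m x) i 0; set v := (A *m y) i 0; set t := b i 0.
(* When both residuals are positive, the gap between the two sides is exactly (u - v)^2. *)
case: (lerP (u - t) 0) => hu; case: (lerP (v - t) 0) => hv.
- by rewrite !(mulr0, mul0r, addr0).
- by rewrite !(mulr0, mul0r, expr0n, addr0) sqr_ge0.
- have := mulr_ge0_le0 (ltW hu) hv; have := sqr_ge0 (u - t); nra.
- have := sqr_ge0 (u - v); nra.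
Qed.

(** Feasibility of [z] makes the inner product at least the signed residual of row [i] at [x];
    multiplying by the positive part, which is zero or equal to it, gives the square. *)
Lemma residual_dotp_ge (R : realType) (m n : nat) (A : 'M[R]_(m, n))
    (b : 'cV[R]_m) (x z : 'cV[R]_n) (i : 'I_m) :
  polyhedron A b z ->
  pos_residual A b x i ^+ 2
    <= pos_residual A b x i * dotp (row_vec A i) (x - z).
Proof.
move=> /(_ i) hz; rewrite dotpDr dotpNr !dotp_row_vec /pos_residual.
set u := (A *m x) i 0; set v := (A *m z) i 0; set t := b i 0.
have {}hz : v <= t by [].
by case: (lerP (u - t) 0); nra.
Qed.

(** * Means over samples, and convexity of the objective *)

Lemma sample_meanD (R : realType) (m beta : nat) (g h : {set 'I_m} -> R) :
  sample_mean beta (fun S => g S + h S)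
  = sample_mean beta g + sample_mean beta h.
Proof. by rewrite /sample_mean big_split mulrDl. Qed.

Lemma sample_meanZ (R : realType) (m beta : nat) (a : R)
    (g : {set 'I_m} -> R) :
  sample_mean beta (fun S => a * g S) = a * sample_mean beta g.
Proof. by rewrite /sample_mean -mulr_sumr mulrA. Qed.

Lemma sample_mean_cst (R : realType) (m beta : nat) (a : R) :
  (beta <= m)%N -> sample_mean beta (fun _ : {set 'I_m} => a) = a.
Proof.
move=> bm; rewrite /sample_mean sumr_const.
have -> : #|[pred S : {set 'I_m} | #|S| == beta]| = 'C(m, beta).
  by rewrite -[in RHS](card_ord m) -card_draws; apply: eq_card => S; rewrite !inE.
by rewrite -[a *+ _]mulr_natr mulfK// pnatr_eq0 -lt0n bin_gt0.
Qed.

Lemma le_sample_mean (R : realType) (m beta : nat) (g h : {set 'I_m} -> R) :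
  (forall S : {set 'I_m}, #|S| = beta -> g S <= h S) ->
  sample_mean beta g <= sample_mean beta h.
Proof.
move=> gh; rewrite ler_wpM2r ?invr_ge0 ?ler0n//.
by apply: ler_sum => S /eqP; exact: gh.
Qed.

Lemma objective_ge0 (R : realType) (m n beta : nat) (A : 'M[R]_(m, n))
    (b : 'cV[R]_m) (x : 'cV[R]_n) : 0 <= objective beta A b x.
Proof.
rewrite mulr_ge0 ?invr_ge0// divr_ge0// sumr_ge0// => S _.
exact: sqr_ge0.
Qed.

(** Averaging one subgradient per sample, residual times row at an active index, works: the factor 2
    from the square cancels the 1/2 in the objective. *)
Lemma objective_subgradient (R : realType) (m n beta : nat)
    (A : 'M[R]_(m, n)) (b : 'cV[R]_m) (x : 'cV[R]_n) :
  (0 < beta)%N ->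
  exists g : 'cV[R]_n, forall y : 'cV[R]_n,
    objective beta A b x + dotp g (y - x) <= objective beta A b y.
Proof.
move=> b0.
(* The empty sample has no active index and ['I_m] may itself be empty, so the choice takes values
   in [option]; [None] contributes the zero vector to [v]. *)
have [i hi] : exists i : {set 'I_m} -> option 'I_m,
    forall S : {set 'I_m}, #|S| = beta ->
    exists2 l, i S = Some l &
      l \in S /\ max_residual A b x S = pos_residual A b x l.
  exists (fun S : {set 'I_m} => [pick l | (l \in S) &&
    (max_residual A b x S == pos_residual A b x l)]) => S Sb.
  case: pickP => [l /andP[lS /eqP]|]; first by exists l.
  have [|l lS e] := max_residual_attained A b x (S := S); first by rewrite Sb.
  by move=> /(_ l); rewrite lS e eqxx.
pose v (S : {set 'I_m}) := oapp (fun l => pos_residual A b x l *: row_vec A l) 0 (i S).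
exists (('C(m, beta))%:R^-1 *: \sum_(S : {set 'I_m} | #|S| == beta) v S) => y.
have -> : dotp (('C(m, beta))%:R^-1 *:
    \sum_(S : {set 'I_m} | #|S| == beta) v S) (y - x)
    = sample_mean beta (fun S => dotp (v S) (y - x)).
  by rewrite dotpZl dotpC dotp_sumr mulrC; congr (_ / _); apply: eq_bigr => S _;
    rewrite dotpC.
rewrite /objective.
have -> : sample_mean beta (fun S => dotp (v S) (y - x))
  = 2^-1 * sample_mean beta (fun S => 2 * dotp (v S) (y - x)).
  by rewrite sample_meanZ mulrA mulVf ?mul1r// pnatr_eq0.
rewrite -mulrDr -sample_meanD ler_wpM2l ?invr_ge0//.
apply: le_sample_mean => S /hi[l il [lS e]].
rewrite /v il /= dotpZl mulrA.
exact: max_residual_subgradient.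
Qed.

(** Jensen's inequality from a single subgradient, taken at the mean: the deviations from the mean
    sum to zero, so the linear terms cancel. *)
Lemma objective_average_le (R : realType) (m n beta : nat)
    (A : 'M[R]_(m, n)) (b : 'cV[R]_m) (x : nat -> 'cV[R]_n) (k : nat) :
  (0 < beta)%N -> (0 < k)%N ->
  k%:R * objective beta A b (average_iterate x k)
    <= \sum_(1 <= l < k.+1) objective beta A b (x l).
Proof.
move=> b0 k0; set xb := average_iterate x k.
have [g hg] := @objective_subgradient R m n beta A b xb b0.
have sumd : \sum_(1 <= l < k.+1) dotp g (x l - xb) = 0.
  rewrite -dotp_sumr sumrB sumr_const_nat subn1 /= -scaler_nat /xb.
  rewrite /average_iterate scalerA mulfV ?pnatr_eq0 -?lt0n// scale1r subrr.
  by rewrite -(scale0r g) dotpZr mul0r.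
have -> : k%:R * objective beta A b xb
  = \sum_(1 <= l < k.+1) (objective beta A b xb + dotp g (x l - xb)).
  by rewrite big_split /= sumd addr0 sumr_const_nat subn1 /= mulr_natl.
by apply: ler_sum => l _; exact: hg.
Qed.

(** * The one-step Lyapunov inequality, averaged over the momentum coordinate *)

Lemma momentum_average (R : realType) (n : nat) (g v q : 'cV[R]_n)
    (al ka ga : R) :
  (0 < n)%N ->
  let u c := - g + (ga * v c 0) *: delta_mx c 0 in
  n%:R^-1 * \sum_(c < n) (al * dotp q (u c) + ka * dotp (u c) (u c))
  = al * (ga / n%:R * dotp q v - dotp q g)
    + ka * (dotp g g - 2 * (ga / n%:R) * dotp g v
            + ga ^+ 2 / n%:R * dotp v v).
Proof.
move=> n0 u.
have nn0 : n%:R != 0 :> R by rewrite pnatr_eq0 -lt0n.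
(* [K] hides the part independent of [c]. The other terms are coordinate products that sum back to
   inner products; since delta vectors have norm 1, the quadratic one keeps ga^2 / n rather than (ga
   / n)^2. *)
have [K KE] : exists K, K = ka * dotp g g - al * dotp q g by eexists.
have term c : al * dotp q (u c) + ka * dotp (u c) (u c)
  = K + (al * ga) * (q c 0 * v c 0)
     - (2 * ka * ga) * (g c 0 * v c 0) + (ka * ga ^+ 2) * (v c 0 * v c 0).
  rewrite KE /u !dotpDr !dotpDl !dotpNr !dotpNl !dotpZr !dotpZl opprK.
  rewrite [dotp (delta_mx c 0) g]dotpC !dotp_delta !mxE !eqxx.
  by rewrite mulr1n; ring.
under eq_bigr => c _ do rewrite term.
rewrite !big_split /= sumrN -!mulr_sumr sumr_const card_ord.
rewrite -[K *+ n]mulr_natl.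
rewrite -/(dotp q v) -/(dotp g v) -/(dotp v v) KE.
by field.
Qed.

(** This is L_k for [x] = x_k and [y] = x_{k-1}. *)
Definition lyapunov (R : realType) (n : nat) (th zeta : R)
    (z x y : 'cV[R]_n) : R :=
  dotp (x + th *: (x - y) - z) (x + th *: (x - y) - z)
    + zeta * dotp (x - y) (x - y).

(** The extrapolated new point is [x + (1 + th) *: u], so the value is quadratic in [u], in the form
    that [momentum_average] handles with al = 2 (1 + th) and ka = (1 + th)^2 + zeta. *)
Lemma lyapunov_increment (R : realType) (n : nat) (th zeta : R)
    (z x u : 'cV[R]_n) :
  lyapunov th zeta z (x + u) x
  = dotp (x - z) (x - z) + (2 * (1 + th) * dotp (x - z) u
                              + ((1 + th) ^+ 2 + zeta) * dotp u u).
Proof.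
rewrite /lyapunov (addrC x u) addrK.
have -> : u + x + th *: u - z = (x - z) + (1 + th) *: u.
  by apply/matrixP => i l; rewrite !mxE; ring.
move: (x - z) => q.
rewrite !(dotpDl, dotpDr, dotpZl, dotpZr) (dotpC u q); ring.
Qed.

Lemma lyapunov_value (R : realType) (n : nat) (th zeta : R)
    (z x y : 'cV[R]_n) :
  lyapunov th zeta z x y
  = dotp (x - z) (x - z) + 2 * th * dotp (x - z) (x - y)
    + (th ^+ 2 + zeta) * dotp (x - y) (x - y).
Proof.
rewrite /lyapunov (addrAC x); move: (x - z) (x - y) => q v.
rewrite !(dotpDl, dotpDr, dotpZl, dotpZr) (dotpC v q); ring.
Qed.

(** Here the sample is fixed and only the coordinate [c] is averaged; [s] and [t] stand for the
    squared maximal residuals of that sample at [x] and [y]. *)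
Lemma lyapunov_average_le (R : realType) (n : nat) (ga zeta de th C s t : R)
    (z x y g : 'cV[R]_n) :
  (0 < n)%N -> 0 <= ga -> ga < n%:R -> 0 <= zeta -> 0 <= de ->
  ga ^+ 2 * (n%:R - 1) / (n%:R - ga) ^+ 2 + zeta * ga ^+ 2 / n%:R <= zeta ->
  dotp g g = s -> s <= dotp g (x - z) -> s + 2 * dotp g (y - x) <= t ->
  th = ga / (n%:R - ga) -> C = (1 + th) ^+ 2 + zeta ->
  n%:R^-1 * \sum_(c < n) lyapunov th zeta z
     (x - de *: g + (ga * (x - y) c 0) *: delta_mx c 0) x
  <= lyapunov th zeta z x y - (2 * de * (1 + th) - C * de ^+ 2) * s
     - de * (ga / n%:R) * C * (s - t).
Proof.
move=> n0 ga0 gan zeta0 de0 hzeta gg gq gv thE CE.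
have nn0 : 0 < n%:R :> R by rewrite ltr0n.
have nga : 0 < n%:R - ga by rewrite subr_gt0.
have th0 : 0 <= th by rewrite thE divr_ge0// ltW.
have C0 : 0 <= C by rewrite CE addr_ge0 ?sqr_ge0.
under eq_bigr => c _ do rewrite -addrA lyapunov_increment.
rewrite big_split /= sumr_const card_ord -[dotp _ _ *+ n]mulr_natl mulrDr.
rewrite mulKf ?gt_eqF// -CE momentum_average//.
rewrite lyapunov_value !dotpZl !dotpZr gg (dotpC (x - z) g).
have gvE : dotp g (y - x) = - dotp g (x - y) by rewrite -dotpNr opprB.
rewrite gvE in gv.
set a := dotp (x - z) (x - z); set qg := dotp g (x - z) in gq *.
set p := dotp g (x - y) in gv *.
set w := dotp (x - z) (x - y); set vv := dotp (x - y) (x - y).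
have vv0 : 0 <= vv by exact: dotp_ge0.
(* This identity dictates [th]: the terms in <x - z, x - y> before and after the step then
   cancel. *)
have e1 : (1 + th) * (ga / n%:R) = th.
  by rewrite thE; field; rewrite !gt_eqF.
(* The coefficient of |x - y|^2 does not grow; after expanding [C], this is literally the condition
   on [zeta]. *)
have e2 : C * (ga ^+ 2 / n%:R) <= th ^+ 2 + zeta.
  have -> : C * (ga ^+ 2 / n%:R) = th ^+ 2 +
     (ga ^+ 2 * (n%:R - 1) / (n%:R - ga) ^+ 2 + zeta * ga ^+ 2 / n%:R).
    by rewrite CE thE; field; rewrite !gt_eqF.
  by rewrite lerD2l.
have h1 : de * (1 + th) * s <= de * (1 + th) * qg.
  by rewrite ler_wpM2l// mulr_ge0// addr_ge0.
have h2 : de * (ga / n%:R) * C * (s - t) <= de * (ga / n%:R) * C * (2 * p).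
  rewrite ler_wpM2l//; last lra.
  by rewrite !mulr_ge0// invr_ge0 ltW.
have h3 := ler_wpM2r vv0 e2.
have -> : 2 * (1 + th) * (ga / n%:R * w - de * qg)
  = 2 * ((1 + th) * (ga / n%:R)) * w - 2 * (de * (1 + th) * qg) by ring.
rewrite e1.
have -> : C * (de * (de * s) - 2 * (ga / n%:R) * (de * p)
   + ga ^+ 2 / n%:R * vv) = C * de ^+ 2 * s
    - de * (ga / n%:R) * C * (2 * p) + C * (ga ^+ 2 / n%:R) * vv by ring.
lra.
Qed.

(** * Finite-valued draws: fibres, atoms and supermartingales *)

Lemma bigsetU_fibers (T : Type) (I : finType) (Y : T -> I) (B : set T) :
  B = \big[setU/set0]_(t <- enum I) (B `&` [set w | Y w = t]).
Proof.
rewrite -bigcup_seq; apply/seteqP; split=> [w Bw|w [t _ []//]].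
by exists (Y w) => //=; rewrite mem_enum.
Qed.

Lemma measurable_fun_fibers (d : measure_display) (T : measurableType d)
    (d' : measure_display) (U : measurableType d') (I : finType) (Y : T -> I)
    (B : set T) (f : T -> U) :
  (forall t, measurable (B `&` [set w | Y w = t])) ->
  (forall t, measurable_fun (B `&` [set w | Y w = t]) f) ->
  measurable_fun B f.
Proof.
move=> mB mf; rewrite (bigsetU_fibers Y B).
elim: (enum I) => [|t s ih]; first by rewrite big_nil; exact: measurable_fun_set0.
rewrite big_cons; apply/measurable_funU => //.
exact: bigsetU_measurable.
Qed.

Lemma ge0_integral_fibers (d : measure_display) (T : measurableType d)
    (R : realType) (mu : {measure set T -> \bar R}) (I : finType) (Y : T -> I)
    (B : set T) (f : T -> \bar R) :
  (forall t, measurable (B `&` [set w | Y w = t])) ->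
  measurable_fun B f -> (forall w, B w -> 0 <= f w)%E ->
  (\int[mu]_(w in B) f w
    = \sum_t \int[mu]_(w in B `&` [set w | Y w = t]) f w)%E.
Proof.
move=> mB mf f0; rewrite [in LHS](bigsetU_fibers Y B) ge0_integral_bigsetU //.
- by rewrite big_enum.
- exact: enum_uniq.
- by move=> s t _ _ [w [[_ <-] [_ <-]]].
- by rewrite -bigsetU_fibers.
- by rewrite -bigsetU_fibers.
Qed.

Lemma measure_fibers (d : measure_display) (T : measurableType d)
    (R : realType) (mu : {measure set T -> \bar R}) (I : finType) (Y : T -> I)
    (B : set T) :
  (forall t, measurable (B `&` [set w | Y w = t])) ->
  (mu B = \sum_t mu (B `&` [set w | Y w = t]))%E.
Proof.
move=> mY; have mB : measurable B.
  by rewrite (bigsetU_fibers Y B); exact: bigsetU_measurable.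
rewrite -[LHS]mul1e -(integral_cst mu mB 1%E).
rewrite (@ge0_integral_fibers _ _ _ _ _ Y)//.
by apply: eq_bigr => t _; rewrite integral_cst// mul1e.
Qed.

(** Indexing by an outcome [w] rather than by a history keeps every atom nonempty. Only draws 1 to k
    - 1 are fixed, so the atom at 1 is the whole space. *)
Definition atom (T I : Type) (Y : nat -> T -> I) (w : T) (k : nat) : set T :=
  [set w' | forall l, (0 < l < k)%N -> Y l w' = Y l w].

Lemma atomS (T I : Type) (Y : nat -> T -> I) (w : T) (k : nat) : (0 < k)%N ->
  atom Y w k.+1 = atom Y w k `&` [set w' | Y k w' = Y k w].
Proof.
move=> k0; apply/seteqP; split=> [w' h|w' [h hk] l].
  split=> [l /andP[l0 lk]|]; apply: h; last by rewrite k0 /=.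
  by rewrite l0 ltnS ltnW.
rewrite ltnS [(l <= k)%N]leq_eqVlt => /andP[l0 /predU1P[->//|lk]].
by apply: h; rewrite l0.
Qed.

Lemma atom_sym (T I : Type) (Y : nat -> T -> I) (w w' : T) (k : nat) :
  atom Y w k w' -> atom Y w k = atom Y w' k.
Proof.
move=> h; apply/seteqP; split=> v hv l hl; first by rewrite hv ?h.
by rewrite hv// h.
Qed.

Lemma measurable_atom (d : measure_display) (T : measurableType d)
    (I : Type) (Y : nat -> T -> I) (w : T) (k : nat) :
  (forall l t, (0 < l)%N -> measurable [set w | Y l w = t]) ->
  measurable (atom Y w k).
Proof.
move=> mY; elim: k => [|[|k] ih].
- by have -> : atom Y w 0 = setT by apply/seteqP; split=> // w' _ l /andP[].
- by have -> : atom Y w 1 = setT by apply/seteqP; split=> // w' _ [].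
- by rewrite atomS//; apply: measurableI => //; exact: mY.
Qed.

(* An adapted process is described by its values W k on atoms, and V k w t is
   its next value on the part of the atom of w where the k-th draw is t. *)
Lemma finite_supermartingale_bound (d : measure_display)
    (T : measurableType d) (R : realType) (P : probability T R) (I : finType)
    (Y : nat -> T -> I) (W : nat -> T -> R) (V : nat -> T -> I -> R)
    (G : T -> R) (K : nat) :
  (forall l t, (0 < l)%N -> measurable [set w | Y l w = t]) ->
  (forall w k w', (0 < k)%N -> atom Y w k w' -> W k.+1 w' = V k w (Y k w')) ->
  (forall w k, (0 < k)%N ->
     \sum_t fine (P (atom Y w k `&` [set w' | Y k w' = t])) * V k w t
     <= fine (P (atom Y w k)) * W k w) ->
  (0 < K)%N -> (forall w w', atom Y w K w' -> G w' = G w) ->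
  (forall w, 0 <= G w) -> (forall w, G w <= W K w) ->
  forall w, (\int[P]_w' (G w')%:E <= (W 1%N w)%:E)%E.
Proof.
move=> mY WV hV K0 Gdet G0 GW w.
have mA v k : measurable (atom Y v k) by exact: measurable_atom.
have fP (B : set T) : measurable B -> (fine (P B))%:E = P B.
  by move=> mB; rewrite fineK// fin_num_measure.
(* Backward induction with s = K - k: [G] is constant on atoms at [K], and an atom at [k] splits
   along the k-th draw. Measurability of [G] is built up piece by piece in the same induction. *)
suff main s : forall k v, (0 < k)%N -> (k + s)%N = K ->
    measurable_fun (atom Y v k) G /\
    (\int[P]_(w' in atom Y v k) (G w')%:E
       <= (fine (P (atom Y v k)) * W k v)%:E)%E.
  have [_] := main K.-1 1%N w isT (prednK K0).
  have -> : atom Y w 1 = setT by apply/seteqP; split=> // w' _ [].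
  by rewrite probability_setT/= mul1r.
elim: s => [|s ih] k v k0.
  rewrite addn0 => ->.
  have Gv : {in atom Y v K, G =1 cst (G v)}.
    by move=> w' /set_mem; exact: Gdet.
  split; first by apply: (eq_measurable_fun (cst (G v))) => [w' /Gv|].
  rewrite (eq_integral (cst (G v)%:E)) => [|w' /Gv -> //].
  rewrite integral_cst// EFinM fP// muleC lee_wpmul2l//.
  by rewrite lee_fin.
rewrite addnS -addSn => ks.
pose B t := atom Y v k `&` [set w' | Y k w' = t].
have mB t : measurable (B t) by apply: measurableI => //; exact: mY.
have piece t : measurable_fun (B t) G /\
    (\int[P]_(w' in B t) (G w')%:E <= (fine (P (B t)) * V k v t)%:E)%E.
  (* An empty piece has no point at which to read [V] as a value of [W], but there both sides
     vanish. A nonempty piece is the next atom of any of its points. *)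
  have [->|/set0P[w' [vw' tw']]] := eqVneq (B t) set0.
    rewrite integral_set0 measure0 mul0r; split=> //.
    exact: measurable_fun_set0.
  have -> : B t = atom Y w' k.+1 by rewrite atomS// /B tw' (atom_sym vw').
  have [mG] := ih k.+1 w' isT ks.
  by rewrite (WV v) // tw'.
have mG : measurable_fun (atom Y v k) G.
  by apply: (@measurable_fun_fibers _ _ _ _ _ (Y k)) => // t; case: (piece t).
split=> //.
rewrite (@ge0_integral_fibers _ _ _ _ _ (Y k))//; last 2 first.
- exact/measurable_EFinP.
- by move=> w' _; rewrite lee_fin.
apply: (@le_trans _ _ (\sum_t (fine (P (B t)) * V k v t)%:E)%E).
  by apply: lee_sum => t _; case: (piece t).
by rewrite sumEFin lee_fin; exact: hV.
Qed.

(** For t > 0, the square root of [t] is a lower bound of the distances, hence at most their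
    infimum. This turns a bound valid for each [z] into one with the distance itself. *)
Lemma le_dist_to_sqr (R : realType) (n : nat) (x : 'cV[R]_n)
    (S : set 'cV[R]_n) (t : R) :
  S !=set0 -> (forall z, S z -> t <= enorm (x - z) ^+ 2) ->
  t <= dist_to x S ^+ 2.
Proof.
move=> [z0 Sz0] h; have [t0|t0] := lerP t 0.
  exact: le_trans t0 (sqr_ge0 _).
have lb : Num.sqrt t <= dist_to x S.
  apply: lb_le_inf; first by exists (enorm (x - z0)); exists z0.
  move=> _ [z Sz <-]; have := ler_wsqrtr (h z Sz).
  by rewrite sqrtr_sqr ger0_norm// sqrtr_ge0.
rewrite -(sqr_sqrtr (ltW t0)) lerXn2r// nnegrE ?sqrtr_ge0//.
exact: le_trans (sqrtr_ge0 _) lb.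
Qed.

(** * The SSKM process: adaptedness, conditional means and the averaged bound *)

Definition sskm_draws (Omega : Type) (m n : nat)
    (tau : nat -> Omega -> {set 'I_m}) (istar : nat -> Omega -> 'I_m)
    (j : nat -> Omega -> 'I_n) (k : nat) (w : Omega) :
    {set 'I_m} * 'I_m * 'I_n :=
  (tau k w, istar k w, j k w).

Lemma sskm_iterate_atom (R : realType) (d : measure_display)
    (Omega : measurableType d) (P : probability Omega R) (m n beta : nat)
    (A : 'M[R]_(m, n)) (b : 'cV[R]_m) (delta gamma : R) (x0 : 'cV[R]_n)
    (tau : nat -> Omega -> {set 'I_m}) (istar : nat -> Omega -> 'I_m)
    (j : nat -> Omega -> 'I_n) (X : nat -> Omega -> 'cV[R]_n) :
  is_SSKM P beta A b delta gamma x0 tau istar j X ->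
  forall w w' k, atom (sskm_draws tau istar j) w k w' ->
  forall l, (l <= k)%N -> X l w' = X l w.
Proof.
move=> hX w w' k ww' l.
(* The recursion reads two earlier iterates, so the induction carries both. Iterate [l] uses draws
   up to l - 1 only, which the atom at [k] fixes. *)
suff : (l <= k)%N -> X l w' = X l w /\ X l.-1 w' = X l.-1 w.
  by move=> h /h[].
elim: l => [|[|l] ih] lk.
- by rewrite !(sskm_init0 hX).
- by rewrite /= !(sskm_init0 hX) !(sskm_init1 hX).
have [e1 e0] := ih (ltnW lk).
split=> //; rewrite !(sskm_step hX _ (ltn0Sn l)) e1 e0.
by have [_ -> ->] := ww' l.+1 lk.
Qed.

Lemma sskm_draws_measurable (R : realType) (d : measure_display)
    (Omega : measurableType d) (P : probability Omega R) (m n beta : nat)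
    (A : 'M[R]_(m, n)) (b : 'cV[R]_m) (delta gamma : R) (x0 : 'cV[R]_n)
    (tau : nat -> Omega -> {set 'I_m}) (istar : nat -> Omega -> 'I_m)
    (j : nat -> Omega -> 'I_n) (X : nat -> Omega -> 'cV[R]_n) :
  is_SSKM P beta A b delta gamma x0 tau istar j X ->
  forall k t, (0 < k)%N ->
  measurable [set w | sskm_draws tau istar j k w = t].
Proof.
move=> hX k [[S i] c] k0.
have -> : [set w | sskm_draws tau istar j k w = (S, i, c)] =
   [set w | tau k w = S] `&` [set w | istar k w = i] `&` [set w | j k w = c].
  apply/seteqP; split=> [w [e1 e2 e3]|w [[/= <- <-] <-] //].
  by split; [split|].
apply: measurableI; last exact: (sskm_j_measurable hX).
apply: measurableI; first exact: (sskm_tau_measurable hX).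
exact: (sskm_istar_measurable hX).
Qed.

(** Given the past, the sample and the chosen row, the coordinate is uniform, so it is averaged
    first. The resulting bound [U] depends on the sample alone; summing over the chosen row then
    removes the tie-breaking rule and leaves the uniform law of the sample. *)
Lemma sskm_draw_average (R : realType) (d : measure_display)
    (Omega : measurableType d) (P : probability Omega R) (m n beta : nat)
    (A : 'M[R]_(m, n)) (b : 'cV[R]_m) (delta gamma : R) (x0 : 'cV[R]_n)
    (tau : nat -> Omega -> {set 'I_m}) (istar : nat -> Omega -> 'I_m)
    (j : nat -> Omega -> 'I_n) (X : nat -> Omega -> 'cV[R]_n)
    (w : Omega) (k : nat) (N : {set 'I_m} -> 'I_m -> 'I_n -> R)
    (U : {set 'I_m} -> R) :
  is_SSKM P beta A b delta gamma x0 tau istar j X -> (0 < k)%N ->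
  (forall (S : {set 'I_m}) (i : 'I_m), #|S| = beta -> i \in S ->
     max_residual A b (X k w) S = pos_residual A b (X k w) i ->
     n%:R^-1 * \sum_(c < n) N S i c <= U S) ->
  \sum_t fine (P (atom (sskm_draws tau istar j) w k
                    `&` [set w' | sskm_draws tau istar j k w' = t]))
         * N t.1.1 t.1.2 t.2
  <= fine (P (atom (sskm_draws tau istar j) w k)) * sample_mean beta U.
Proof.
move=> hX k0 NU; set B := atom _ w k.
have mB : measurable B.
  exact: measurable_atom (sskm_draws_measurable hX).
have mS S : measurable (B `&` [set w' | tau k w' = S]).
  by apply: measurableI => //; exact: (sskm_tau_measurable hX).
have mi S i : measurable
    (B `&` [set w' | tau k w' = S] `&` [set w' | istar k w' = i]).
  by apply: measurableI => //; exact: (sskm_istar_measurable hX).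
pose q S i := fine (P
    (B `&` [set w' | tau k w' = S] `&` [set w' | istar k w' = i])).
have qc S i c :
    fine (P (B `&` [set w' | sskm_draws tau istar j k w' = (S, i, c)]))
    = q S i * n%:R^-1.
  have -> : B `&` [set w' | sskm_draws tau istar j k w' = (S, i, c)]
     = B `&` [set w' | tau k w' = S] `&` [set w' | istar k w' = i]
         `&` [set w' | j k w' = c].
    apply/seteqP; split=> [w' [Bw' [e1 e2 e3]]//|w' [[[Bw' /= e1] e2] e3]].
    by split=> //=; rewrite /sskm_draws e1 e2 e3.
  (* By unfolding, the atom of [w] is [past] at the history that [w] realizes. *)
  rewrite (sskm_j_uniform hX (fun l => sskm_draws tau istar j l w))//.
  by rewrite fineM ?fin_num_measure//; exact: mi.
have qS S : \sum_i q S i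
    = if #|S| == beta then fine (P B) * ('C(m, beta))%:R^-1 else 0.
  have -> : \sum_i q S i = fine (P (B `&` [set w' | tau k w' = S])).
    rewrite (@measure_fibers _ _ _ _ _ (istar k))//.
    by rewrite -sum_fine// => i _; rewrite fin_num_measure.
  case: eqP => Sb.
    rewrite (sskm_tau_uniform hX (fun l => sskm_draws tau istar j l w))//.
    by rewrite fineM ?fin_num_measure//; exact: mB.
  have -> : B `&` [set w' | tau k w' = S] = set0; last by rewrite measure0.
  rewrite -subset0 => w' [_ /= tS]; apply: Sb.
  by rewrite -tS (sskm_tau_card hX).
have q0 S i : 0 <= q S i by rewrite fine_ge0.
(* The hypothesis speaks only of maximizing rows. A pair (S, i) of nonzero weight is realized at
   some point of the atom, where iterate [k] is the same as at [w], so [i] is maximizing; other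
   pairs contribute zero. *)
have NUq S i : q S i * (n%:R^-1 * \sum_(c < n) N S i c) <= q S i * U S.
  have [q_eq0|qn0] := eqVneq (q S i) 0; first by rewrite q_eq0 !mul0r.
  have [w' [[Bw' /= tS] /= ii]] :
      (B `&` [set w' | tau k w' = S] `&` [set w' | istar k w' = i]) !=set0.
    by apply/set0P; apply: contra_neq qn0; rewrite /q => ->; rewrite measure0.
  have eX := sskm_iterate_atom hX Bw' (leqnn k).
  have iS : i \in S by rewrite -ii -tS (sskm_istar_mem hX).
  rewrite ler_wpM2l// NU//; first by rewrite -tS (sskm_tau_card hX).
  apply: max_residual_eq => // l; rewrite -tS -ii -eX.
  exact: (sskm_istar_max hX).
rewrite (eq_bigr (fun t => q t.1.1 t.1.2 * n%:R^-1 * N t.1.1 t.1.2 t.2));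
  last by move=> [[S i] c] _; rewrite qc.
rewrite -(pair_bigA _ (fun Si c => q Si.1 Si.2 * n%:R^-1 * N Si.1 Si.2 c))/=.
rewrite -(pair_bigA _ (fun S i =>
  \sum_(c < n) q S i * n%:R^-1 * N S i c))/=.
apply: (@le_trans _ _ (\sum_S \sum_i q S i * U S)).
  by apply: ler_sum => S _; apply: ler_sum => i _; rewrite -mulr_sumr -mulrA.
rewrite /sample_mean mulr_suml mulr_sumr [leRHS]big_mkcond/=.
apply: ler_sum => S _; rewrite -mulr_suml qS.
by case: ifP => _; rewrite ?mul0r// -mulrA [_^-1 * _]mulrC.
Qed.

Lemma sskm_average_objective_le (R : realType) (d : measure_display)
    (Omega : measurableType d) (P : probability Omega R) (m n beta : nat)
    (A : 'M[R]_(m, n)) (b : 'cV[R]_m) (delta gamma zeta th C r : R)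
    (x0 z : 'cV[R]_n)
    (tau : nat -> Omega -> {set 'I_m}) (istar : nat -> Omega -> 'I_m)
    (j : nat -> Omega -> 'I_n) (X : nat -> Omega -> 'cV[R]_n) (k : nat) :
  is_SSKM P beta A b delta gamma x0 tau istar j X ->
  (forall i : 'I_m, enorm (row_vec A i) = 1) -> polyhedron A b z ->
  (0 < n)%N -> (1 <= beta <= m)%N -> 0 <= gamma -> gamma < n%:R ->
  0 <= zeta -> 0 <= delta ->
  gamma ^+ 2 * (n%:R - 1) / (n%:R - gamma) ^+ 2 + zeta * gamma ^+ 2 / n%:R
    <= zeta ->
  th = gamma / (n%:R - gamma) -> C = (1 + th) ^+ 2 + zeta ->
  r = 4 * delta * (1 + th) - 2 * C * delta ^+ 2 -> 0 < r -> (0 < k)%N ->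
  (\int[P]_w (objective beta A b (average_iterate (fun l => X l w) k))%:E
   <= ((r * k%:R)^-1 * (dotp (x0 - z) (x0 - z)
         + 2 * delta * (gamma / n%:R) * C * objective beta A b x0))%:E)%E.
Proof.
move=> hX hA hz n0 /andP[b0 bm] ga0 gan zeta0 de0 hzeta thE CE rE r0 k0.
pose f := objective beta A b.
pose a := 2 * delta * (gamma / n%:R) * C.
pose kap := (r * k%:R)^-1.
have k0R : 0 < k%:R :> R by rewrite ltr0n.
have kap0 : 0 <= kap by rewrite invr_ge0 mulr_ge0// ltW.
have C0 : 0 <= C by rewrite CE addr_ge0 ?sqr_ge0.
have a0 : 0 <= a by rewrite !mulr_ge0// invr_ge0 ler0n.
have f0 x : 0 <= f x by exact: objective_ge0.
pose Y := sskm_draws tau istar j.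
(* The supermartingale is divided by r k, so that its last value dominates the objective at the
   average. [V] below is its next value, with x_{l+1} written as [next]. *)
pose W l w := kap * (lyapunov th zeta z (X l w) (X l.-1 w) + a * f (X l.-1 w)
  + r * \sum_(1 <= i < l) f (X i w)).
pose next l w i c := X l w - delta *: (pos_residual A b (X l w) i *: row_vec A i)
  + (gamma * (X l w - X l.-1 w) c 0) *: delta_mx c 0.
pose V l w (t : {set 'I_m} * 'I_m * 'I_n) :=
  kap * (lyapunov th zeta z (next l w t.1.2 t.2) (X l w) + (a * f (X l w)
  + r * \sum_(1 <= i < l.+1) f (X i w))).
(* A space of total mass 1 has a point, at which the initial value is read; there x_1 = x_0 kills
   the momentum terms and the sum is empty. *)
have [w0 _] : [set: Omega] !=set0.
  apply/set0P/eqP => T0; have := @probability_setT _ _ _ P.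
  by rewrite T0 measure0 => /eqP; rewrite eq_sym onee_eq0.
have <- : W 1%N w0 = kap * (dotp (x0 - z) (x0 - z) + a * f x0).
  rewrite /W big_geq// mulr0 addr0 /= (sskm_init0 hX) (sskm_init1 hX).
  by rewrite lyapunov_value subrr -(scale0r x0) !dotpZr !(mul0r, mulr0) !addr0.
(* The horizon is k + 1: only then does the sum in [W] run over f(x_1), ..., f(x_k), as Jensen's
   inequality requires. *)
apply: (@finite_supermartingale_bound _ _ _ _ _ Y W V _ k.+1) => //.
- exact: sskm_draws_measurable hX.
- move=> w l w' l0 ww'; rewrite /W /V /next /= (sskm_step hX)//.
  have eX := sskm_iterate_atom hX ww'.
  rewrite scalerA !eX ?leq_pred// addrA; congr (kap * (_ + r * _)).
  by apply: eq_big_nat => i /andP[_ il]; rewrite eX.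
- move=> w l l0.
  pose S2 x (S : {set 'I_m}) := max_residual A b x S ^+ 2.
  pose K := lyapunov th zeta z (X l w) (X l.-1 w) + (a * f (X l w)
    + r * \sum_(1 <= i < l.+1) f (X i w)).
  (* The mean of [S2 x] is 2 f(x). With r = 2 (2 delta (1 + th) - C delta^2) and a = 2 delta (gamma
     / n) C, the f(x_l) terms beyond the Lyapunov value cancel in the mean, leaving exactly
     [W l w]. *)
  pose U S := kap * (K + - (2 * delta * (1 + th) - C * delta ^+ 2
      + delta * (gamma / n%:R) * C) * S2 (X l w) S
      + delta * (gamma / n%:R) * C * S2 (X l.-1 w) S).
  have -> : W l w = sample_mean beta U.
    have mean2 x : sample_mean beta (S2 x) = 2 * f x.
      by rewrite /f /objective mulrA mulfV ?mul1r.
    have meanU (K' p q : R) x y : sample_mean beta (fun S =>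
        kap * (K' + p * S2 x S + q * S2 y S))
        = kap * (K' + p * (2 * f x) + q * (2 * f y)).
      by rewrite sample_meanZ !sample_meanD sample_mean_cst// !sample_meanZ !mean2.
    by rewrite /U meanU /W /K big_nat_recr//= rE /a; ring.
  pose N (S : {set 'I_m}) i c := kap *
    (lyapunov th zeta z (next l w i c) (X l w) + (a * f (X l w)
      + r * \sum_(1 <= i < l.+1) f (X i w))).
  apply: (sskm_draw_average (N := N) (U := U) hX l0) => S i Sb iS Si.
  have rowE : dotp (row_vec A i) (row_vec A i) = 1.
    by rewrite -enorm_sqr hA expr1n.
  have key := @lyapunov_average_le R n gamma zeta delta th C
    (S2 (X l w) S) (S2 (X l.-1 w) S) z (X l w) (X l.-1 w)
    (pos_residual A b (X l w) i *: row_vec A i).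
  rewrite /N -mulr_sumr big_split/= sumr_const card_ord mulrCA mulrDr.
  rewrite -[(_ + _) *+ n]mulr_natl mulKf ?pnatr_eq0 -?lt0n//.
  rewrite /U ler_wpM2l//.
  apply: (@le_trans _ _ (lyapunov th zeta z (X l w) (X l.-1 w)
    - (2 * delta * (1 + th) - C * delta ^+ 2) * S2 (X l w) S
    - delta * (gamma / n%:R) * C * (S2 (X l w) S - S2 (X l.-1 w) S)
    + (a * f (X l w) + r * \sum_(1 <= i < l.+1) f (X i w)))).
    rewrite lerD2r; apply: key => //.
    + by rewrite dotpZl dotpZr rowE mulr1 -expr2 /S2 Si.
    + by rewrite dotpZl /S2 Si; exact: residual_dotp_ge.
    + by rewrite dotpZl mulrA; exact: max_residual_subgradient.
  by rewrite /K; lra.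
- move=> w w' /(sskm_iterate_atom hX) eX; congr objective.
  by congr (_ *: _); apply: eq_big_nat => l /andP[_ lk]; rewrite eX// ltnW.
- move=> w; rewrite /W.
  have avg := @objective_average_le R m n beta A b (fun l => X l w) k b0 k0.
  rewrite -ler_pdivrMl ?invr_gt0 ?mulr_gt0// invrK -mulrA.
  (* The Lyapunov value and the term in f(x_k) outside the sum are nonnegative and are dropped. *)
  apply: (@le_trans _ _ (r * \sum_(1 <= l < k.+1) f (X l w))).
    by rewrite ler_wpM2l// ltW.
  rewrite lerDr addr_ge0//; last by rewrite mulr_ge0// f0.
  by rewrite /lyapunov addr_ge0 ?mulr_ge0 ?dotp_ge0.
Qed.

(** * The explicit constants, and minimization over the polyhedron *)

Unset Implicit Arguments.
Set Strict Implicit.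

Theorem theorem6p18 (R : realType) (m n : nat) (A : 'M[R]_(m, n))
    (b : 'cV[R]_m)
    (hA : forall i : 'I_m, enorm (row_vec A i) = 1)
    (hP : polyhedron A b !=set0)
    (beta : nat) (hbeta : (1 <= beta <= m)%N)
    (gamma zeta delta : R)
    (hgamma : 0 <= gamma < Num.sqrt n%:R)
    (hzeta0 : 0 <= zeta)
    (hzeta : gamma ^+ 2 * (n%:R - 1) / (n%:R - gamma) ^+ 2
               + zeta * gamma ^+ 2 / n%:R <= zeta)
    (hdelta0 : 0 < delta)
    (hdelta : delta < Num.min 2 (2 * n%:R * (n%:R - gamma)
                 / (n%:R ^+ 2 + zeta * (n%:R - gamma) ^+ 2)))
    (x0 : 'cV[R]_n)
    (d : measure_display) (Omega : measurableType d)
    (P : probability Omega R)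
    (tau : nat -> Omega -> {set 'I_m}) (istar : nat -> Omega -> 'I_m)
    (j : nat -> Omega -> 'I_n) (X : nat -> Omega -> 'cV[R]_n)
    (hX : is_SSKM P beta A b delta gamma x0 tau istar j X)
    (k : nat) (hk : (1 <= k)%N) :
  ('E_P[fun w => objective beta A b (average_iterate (fun l => X l w) k)] <=
   ((n%:R * (n%:R - gamma) ^+ 2 * dist_to x0 (polyhedron A b) ^+ 2
       + 2 * gamma * delta * (n%:R ^+ 2 + zeta * (n%:R - gamma) ^+ 2)
           * objective beta A b x0)
     / (2 * delta * k%:R * n%:R
          * (2 * n%:R * (n%:R - gamma) - zeta * delta * (n%:R - gamma) ^+ 2
               - delta * n%:R ^+ 2)))%:E)%E.
Proof.
have /andP[ga0 gan] := hgamma.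
(* For n = 0 the range of [gamma] would be empty. *)
have n0 : (0 < n)%N.
  by case: n {A hA hP hzeta hdelta x0 j X hX hgamma} gan => //;
    rewrite sqrtr0 ltNge ga0.
have n1 : 1 <= n%:R :> R by rewrite ler1n.
have {}gan : gamma < n%:R.
  apply: lt_le_trans gan _; rewrite -{2}[n%:R]ger0_norm ?ler0n// -sqrtr_sqr.
  by rewrite ler_wsqrtr// expr2 ler_peMl.
have nga : 0 < n%:R - gamma by rewrite subr_gt0.
pose D := n%:R ^+ 2 + zeta * (n%:R - gamma) ^+ 2.
have n0R : 0 < n%:R :> R by rewrite ltr0n.
have D0 : 0 < D.
  apply: ltr_pwDl; first exact: exprn_gt0.
  by apply: mulr_ge0 => //; exact: sqr_ge0.
(* The second bound in the minimum with its denominator cleared; this quantity is the last factor of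
   the stated denominator, and it governs the sign of [r]. *)
have q0 : 0 < 2 * n%:R * (n%:R - gamma) - delta * D.
  move: hdelta; rewrite lt_min => /andP[_].
  by rewrite ltr_pdivlMr// -subr_gt0.
set q := (X in 0 < X) in q0.
have qE : 2 * n%:R * (n%:R - gamma) - zeta * delta * (n%:R - gamma) ^+ 2
    - delta * n%:R ^+ 2 = q by rewrite /q /D; ring.
rewrite qE -/D.
have k0R : 0 < k%:R :> R by rewrite ltr0n.
pose th := gamma / (n%:R - gamma); pose C := (1 + th) ^+ 2 + zeta.
pose r := 4 * delta * (1 + th) - 2 * C * delta ^+ 2.
have rE : r = 2 * delta * q / (n%:R - gamma) ^+ 2.
  by rewrite /r /C /th /q /D; field; rewrite gt_eqF.
have r0 : 0 < r by rewrite rE divr_gt0 ?mulr_gt0 ?exprn_gt0.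
set f0 := objective beta A b x0.
(* [al] equals 1 / (r k), and [be] is the share of f(x_0), so the target reads al d(x_0, P)^2 +
   be. *)
pose al := (n%:R - gamma) ^+ 2 / (2 * delta * k%:R * q).
pose be := 2 * gamma * delta * D * f0 / (2 * delta * k%:R * n%:R * q).
have al0 : 0 < al by rewrite divr_gt0 ?mulr_gt0 ?exprn_gt0.
have bound z : polyhedron A b z ->
    ('E_P[fun w => objective beta A b (average_iterate (fun l => X l w) k)]
      <= (al * enorm (x0 - z) ^+ 2 + be)%:E)%E.
  move=> hz; rewrite unlock.
  have -> : al * enorm (x0 - z) ^+ 2 + be = (r * k%:R)^-1 *
      (dotp (x0 - z) (x0 - z) + 2 * delta * (gamma / n%:R) * C * f0).
    rewrite enorm_sqr rE /al /be /C /th /D.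
    by field; rewrite !gt_eqF.
  exact: (sskm_average_objective_le hX hA hz n0 hbeta ga0 gan hzeta0
    (ltW hdelta0) hzeta erefl erefl erefl r0 hk).
have -> : (n%:R * (n%:R - gamma) ^+ 2 * dist_to x0 (polyhedron A b) ^+ 2
    + 2 * gamma * delta * D * f0) / (2 * delta * k%:R * n%:R * q)
  = al * dist_to x0 (polyhedron A b) ^+ 2 + be.
  by rewrite /al /be; field; rewrite !gt_eqF.
(* The bound at one feasible point excludes an infinite upper value. For a finite expectation e,
   each bound is solved for |x_0 - z|^2, and the infimum over [z] can be taken. *)
have [z0 hz0] := hP; have := bound z0 hz0; move: bound.
case: ('E_P[_])%E => [e| |] bound; rewrite ?leNye// => _.
rewrite lee_fin -lerBlDr -ler_pdivrMl//.
apply: le_dist_to_sqr => // z hz.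
by rewrite ler_pdivrMl// lerBlDr -lee_fin; exact: bound.
Qed.
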